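(* Let $Q=T[H_1,\dots,H_t]$ be a semicomplete composition (with $T$ on vertices $u_1,\dots,u_t$, $t\ge 2$) that has a 3-king. If $T$ has no source, then $Q$ has at least two 3-kings. In particular, every strong semicomplete composition $Q=T[H_1,\dots,H_t]$ has at least two 3-kings, and for such $Q$ a vertex $v\in V(H_i)$ is a 3-king of $Q$ if and only if $u_i$ is a 3-king of $T$.
   Context: All digraphs are finite, without loops or parallel arcs; paths are directed. Let $T$ be a digraph with vertices $u_1,\dots,u_t$ ($t\ge 2$) and $H_1,\dots,H_t$ digraphs, $H_i$ having vertices $u_{i,j}$, $1\le j\le n_i$. The composition $Q=T[H_1,\dots,H_t]$ has vertex set $\{u_{i,j}\}$ and arc set $\bigcup_i A(H_i)\cup\{u_{i,j}u_{p,q}: u_iu_p\in A(T)\}$ (all $j,q$). It is a semicomplete composition if $T$ is semicomplete, i.e. between every two distinct vertices of $T$ there is at least one arc. A digraph is strong if every vertex can reach every other vertex by a directed path. A source is a vertex of in-degree $0$. A 3-king of a digraph $D$ is a vertex from which every other vertex can be reached by a directed path of length at most 3. *)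

(* Defs.v *)
From HB Require Import structures.
From mathcomp Require Import all_boot.

Set Implicit Arguments.
Unset Strict Implicit.
Unset Printing Implicit Defensive.

(* A boolean relation rules out parallel arcs but allows 2-cycles. *)
Record digraph := Digraph {
  vertex :> finType;
  arc : rel vertex;
  arc_irr : irreflexive arc
}.

Definition semicomplete (D : digraph) : Prop :=
  forall x y : D, x != y -> arc x y || arc y x.

(* A path lists its vertices after the first one, as in mathcomp's [path], so
   that [size p] is its length. *)
Definition dipath (D : digraph) (x y : D) (p : seq D) : bool :=
  [&& path (@arc D) x p, last x p == y & uniq (x :: p)].

Definition strong (D : digraph) : Prop :=
  forall x y : D, exists p : seq D, dipath x y p.

Definition indegree (D : digraph) (v : D) : nat := #|[set u : D | arc u v]|.

Definition source (D : digraph) (v : D) : bool := indegree v == 0.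

Definition king (k : nat) (D : digraph) (v : D) : Prop :=
  forall w : D, w != v -> exists p : seq D, dipath v w p /\ size p <= k.

Definition two_kings (k : nat) (D : digraph) : Prop :=
  exists v w : D, [/\ v != w, king k v & king k w].

Section Composition.
Variables (T : digraph) (H : T -> digraph).

(* [tagged_as x y] is the second component of [y] transported to the type of
   that of [x]; it is only meaningful under the guard [tag x == tag y]. *)
Definition comp_arc : rel {i : T & H i} := fun x y =>
  (tag x == tag y) && arc (tagged x) (tagged_as x y) || arc (tag x) (tag y).

Lemma comp_arc_irr : irreflexive comp_arc.
Proof. by case=> i x; rewrite /comp_arc tagged_asE !arc_irr andbF. Qed.

Definition composition : digraph := Digraph comp_arc_irr.

Definition comp_vertex (i : T) (x : H i) : composition :=
  Tagged (fun i : T => vertex (H i)) x.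

End Composition.

(* Main.v *)
Require Import Defs.
From HB Require Import structures.
From mathcomp Require Import all_boot.
(* mathcomp's [path.arc] shadows [Defs.arc]. *)
Import Defs.

(** Between vertices of different parts, distances in [composition H] are those
    of [T]; between vertices of the same part [H i] a closed walk of length at
    most 3 through [i] in [T] suffices. In a semicomplete digraph, such a walk
    exists as soon as [i] reaches one of its in-neighbours, since a shortest
    closed walk of length at least 4 has a chord through [i]. So every 3-king of
    [T] with an in-neighbour lifts to 3-kings of the composition. A vertex [u] of
    maximal out-degree is a 2-king of [T], and if [u] is not a source, a 2-king of
    its in-neighbourhood is a second 2-king of [T]. *)

(** Walks of length at most [k], which may repeat vertices: they can be extended by an arc or
    projected to [T] without restoring [uniq]. *)
Fixpoint within {D : digraph} (k : nat) (x y : D) : bool :=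
  if k is k'.+1 then (x == y) || [exists z, arc x z && within k' z y]
  else x == y.

Lemma within_refl {D : digraph} k (x : D) : within k x x.
Proof. by case: k => [|k] /=; rewrite eqxx. Qed.

Lemma within_cons {D : digraph} k (z x y : D) :
  arc x z -> within k z y -> within k.+1 x y.
Proof. by move=> xz zy; apply/orP; right; apply/existsP; exists z; rewrite xz. Qed.

Lemma within_arc {D : digraph} k (x y : D) : arc x y -> within k.+1 x y.
Proof. by move=> xy; apply: within_cons xy (within_refl k y). Qed.

(** Cutting the cycles out of a walk leaves a path on some of its vertices, hence no longer than the
    walk. *)
Lemma withinP {D : digraph} k (x y : D) :
  within k x y <-> exists p, dipath x y p /\ size p <= k.
Proof.
split=> [xy | [p [/and3P[]]]]; last first.
  elim: k x p => [|k IHk] x [|z p] /=; try by [|move=> _ /eqP->; rewrite eqxx].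
  move=> /andP[xz zp] lp /andP[_ up] sp; apply: within_cons xz _.
  exact: (IHk z p).
suff [p [xp lp sp]] : exists p, [/\ path (@arc D) x p, last x p = y & size p <= k].
  move: lp; case/shortenP: xp => q xq uq sub_qp lq.
  exists q; split; first by rewrite /dipath xq lq eqxx.
  by apply: leq_trans sp; apply: uniq_leq_size sub_qp; case/andP: uq.
elim: k x xy => [|k IHk] x /=; first by move=> /eqP<-; exists [::].
case/orP=> [/eqP<- | /existsP[z /andP[xz /IHk[p [zp lp sp]]]]]; first by exists [::].
by exists (z :: p); rewrite /= xz.
Qed.

Lemma kingP {D : digraph} k (v : D) : king k v <-> forall w, within k v w.
Proof.
split=> [kv w | kv w _]; last exact/withinP.
by have [-> | /kv/withinP] := eqVneq w v; first exact: within_refl.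
Qed.

Lemma leq_within {D : digraph} {k m} {x y : D} :
  k <= m -> within k x y -> within m x y.
Proof.
by move=> km /withinP[p [pxy pk]]; apply/withinP; exists p; rewrite (leq_trans pk).
Qed.

Lemma within_pred {D : digraph} {k} {x y : D} :
  within k x y -> x != y -> exists z, arc z y.
Proof.
elim: k x => [|k IHk] x /=; first by move=> ->.
move=> /orP[-> // | /existsP[z /andP[xz zy]]] _.
by have [<- | /(IHk z zy)] := eqVneq z y; first by exists x.
Qed.

Section Semicomplete.
Context {T : digraph} (hT : semicomplete T).

(** Take [u] of maximal out-degree within [S]. A vertex [w] of [S] not reached in two steps would
    dominate [u] and every out-neighbour of [u] in [S], and so have larger out-degree. *)
Lemma max_outdegree_king (S : {set T}) (u0 : T) : u0 \in S ->
  exists2 u, u \in S & {in S, forall w, within 2 u w}.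
Proof.
move=> Su0; pose N u := [set v in S | arc u v].
have [u /= Su maxu] := @arg_maxnP _ u0 [in S] (fun u => #|N u|) Su0.
exists u => // w Sw; apply/negPn/negP => /= nuw.
have uw : u != w by apply: contraNneq nuw => ->; rewrite eqxx.
have n_arc v : within 1 v w -> ~~ arc u v.
  move=> vw; apply: contra nuw => uv.
  exact: within_cons uv vw.
have wu : arc w u.
  by case/orP: (hT _ _ uw) => //; rewrite (negPf (n_arc w (within_refl _ _))).
have := maxu w Sw; apply/negP; rewrite -ltnNge; apply: proper_card.
apply/properP; split; last by exists u; rewrite !inE Su ?arc_irr.
apply/subsetP=> z; rewrite !inE => /andP[-> uz] /=.
have nzw : ~~ within 1 z w by apply: contraL uz => /n_arc.
have zw : z != w by apply: contraNneq nzw => ->; rewrite within_refl.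
by case/orP: (hT _ _ zw) => // az; case/negP: nzw; apply: within_arc.
Qed.

Lemma two_2kings (u0 : T) : (forall u : T, exists v, arc v u) ->
  two_kings 2 T.
Proof.
move=> has_pred.
have [u _ ku] := @max_outdegree_king setT u0 (in_setT _).
have [v vu] := has_pred u.
have [|w] := @max_outdegree_king [set w | arc w u] v; first by rewrite inE.
rewrite inE => wu kw; exists u, w.
split; [by apply: contraTneq wu => ->; rewrite arc_irr | by apply/kingP=> z; apply: ku |].
(* A vertex [z] that is not an in-neighbour of [u] equals [u] or is dominated by it, so [w] reaches
   it through [u]. *)
apply/kingP=> z; have [zu | nzu] := boolP (arc z u); first by apply: kw; rewrite inE.
apply: (within_cons 1 u) => //.
have [-> | uz] := eqVneq u z; first exact: within_refl.
by apply: within_arc; case/orP: (hT _ _ uz) => //; rewrite (negPf nzu).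
Qed.

(** The first arc is split off because [within 3 i i] already holds by the empty walk. *)
Lemma short_closed_walk k (i b : T) : within k i b -> arc b i ->
  exists2 z, arc i z & within 2 z i.
Proof.
move=> ib bi.
suff aux m z : arc i z -> within m z b -> exists2 z, arc i z & within 2 z i.
  case: k ib => [/eqP ib | k /orP[/eqP ib | /existsP[z /andP[iz zb]]]].
  - by rewrite -ib arc_irr in bi.
  - by rewrite -ib arc_irr in bi.
  - exact: aux iz zb.
elim: m z => [|m IHm] z iz.
  by move=> /eqP zb; exists z => //; apply: within_arc; rewrite zb.
case/orP=> [/eqP zb | /existsP[c /andP[zc cb]]].
  by exists z => //; apply: within_arc; rewrite zb.
have [ci | nci] := eqVneq c i.
  by exists z => //; apply: within_arc; rewrite -ci.
(* Either [c] closes the walk [i], [z], [c], [i], or the chord from [i] to [c] bypasses [z] and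
   leaves a shorter walk to [b]. *)
case/orP: (hT _ _ nci) => [c_i | ic]; last exact: IHm ic cb.
by exists z => //; apply: within_cons zc (within_arc 0 _ _ c_i).
Qed.

End Semicomplete.

Section Composition.
Context {T : digraph} {H : T -> digraph}.

(** An arc inside a part projects to no move at all, any other arc to an arc of [T]. *)
Lemma within_proj k (x y : composition H) :
  within k x y -> within k (tag x) (tag y).
Proof.
elim: k x => [|k IHk] x /=; first by move=> /eqP->.
case/orP=> [/eqP-> | /existsP[z /andP[xz /IHk zy]]]; first by rewrite eqxx.
case/orP: xz => [/andP[/eqP xz _] | xz].
  by apply: (leq_within (leqnSn k)); rewrite xz.
exact: within_cons xz zy.
Qed.

Hypothesis hH : forall i : T, 1 <= #|H i|.

Lemma part_vertex (i : T) : exists x : H i, true.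
Proof. by have /card_gt0P[x _] := hH i; exists x. Qed.

(** Arcs between parts join all pairs, so inner vertices of the walk lift arbitrarily and its last
    arc can end at [y] itself. The separate first arc makes this work even when [x] and [y] share a
    part. *)
Lemma within_lift k (z : T) (x y : composition H) :
  arc (tag x) z -> within k z (tag y) -> within k.+1 x y.
Proof.
have step m (x' : composition H) : arc (tag x') (tag y) -> within m.+1 x' y.
  by move=> xy; apply: within_arc; apply/orP; right.
elim: k x z => [|k IHk] x z xz; first by move=> /eqP zy; apply: step; rewrite -zy.
case/orP=> [/eqP zy | /existsP[c /andP[zc cy]]]; first by apply: step; rewrite -zy.
have [w _] := part_vertex z.
apply: (within_cons _ (comp_vertex w)); first by apply/orP; right.
exact: (IHk (comp_vertex w) c).
Qed.

Lemma king_comp_vertex (hT : semicomplete T) (i b : T) (x : H i) :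
  arc b i -> king 3 i -> king 3 (comp_vertex x).
Proof.
move=> bi /kingP ki; apply/kingP=> y.
have [iy | niy] := eqVneq i (tag y).
  have [z iz zi] := short_closed_walk hT _ _ _ (ki b) bi.
  by apply: (within_lift 2 z); rewrite // -iy.
have /orP[/eqP iy | /existsP[z /andP[iz zy]]] := ki (tag y).
  by rewrite iy eqxx in niy.
exact: (within_lift 2 z).
Qed.

Lemma comp_vertex_king k (i : T) (x : H i) :
  king k (comp_vertex x) -> king k i.
Proof.
move=> /kingP kx; apply/kingP=> j.
by have [y _] := part_vertex j; exact: within_proj (kx (comp_vertex y)).
Qed.

Lemma two_3kings_comp (hT : semicomplete T) (u0 : T) :
  (forall u : T, exists v, arc v u) -> two_kings 3 (composition H).
Proof.
move=> has_pred.
have king_lift u (x : H u) : king 2 u -> king 3 (comp_vertex x).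
  have [v vu] := has_pred u; move=> /kingP ku.
  by apply: king_comp_vertex vu _ => //; apply/kingP=> w; apply: leq_within (ku w).
have [u [w [uw ku kw]]] := two_2kings hT u0 has_pred.
have [x _] := part_vertex u; have [y _] := part_vertex w.
exists (comp_vertex x), (comp_vertex y); split; try exact: king_lift.
by apply: contraNneq uw => /(congr1 tag)/= ->.
Qed.

(** A path into the part of [u] from another part projects to a nonempty walk of [T], whose last arc
    enters [u]. *)
Lemma strong_comp_pred : 2 <= #|T| -> strong (composition H) ->
  forall u : T, exists v, arc v u.
Proof.
move=> ht sQ u.
have /card_gt0P[v] : 0 < #|[set~ u]| by rewrite cardsC1 -ltnS prednK // ltnW.
rewrite !inE => vu; have [x _] := part_vertex v; have [y _] := part_vertex u.
have [p pxy] := sQ (comp_vertex x) (comp_vertex y).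
have /within_proj xy : within (size p) (comp_vertex x) (comp_vertex y).
  by apply/withinP; exists p.
exact: within_pred xy vu.
Qed.

End Composition.

Theorem theorem2p8 (T : digraph) (H : T -> digraph)
  (ht : 2 <= #|T|) (hH : forall i : T, 1 <= #|H i|) (hT : semicomplete T) :
  ((exists v : composition H, king 3 v) -> (forall u : T, ~~ source u) ->
     two_kings 3 (composition H))
  /\
  (strong (composition H) ->
     two_kings 3 (composition H) /\
     (forall (i : T) (x : H i), king 3 (comp_vertex x) <-> king 3 i)).
Proof.
have /card_gt0P[u0 _] : 0 < #|T| by exact: ltnW.
split=> [_ nsrc | sQ].
  apply: (two_3kings_comp hH hT u0) => u; move: (nsrc u).
  by rewrite /source /indegree -lt0n => /card_gt0P[v]; rewrite inE; exists v.
have has_pred := strong_comp_pred hH ht sQ.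
split; first exact: (two_3kings_comp hH hT u0).
move=> i x; split; first exact: comp_vertex_king.
by have [b bi] := has_pred i; apply: king_comp_vertex bi.
Qed.
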